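(* Let $d\ge 0$, $c_1,\ldots,c_d\in\mathbb{N}\setminus\{2\}$, and $a_0,a_1,\ldots,a_d\ge 0$ be integers such that $c_1\ge 3$ if $a_0=0$ and $d\ge 1$, and $a_0\ge 1$ if $d=0$. Let $k_{-1}=0$, and let $\delta(c)=2$ if $c=0$, $\delta(c)=1$ if $c=1$, $\delta(c)=0$ if $c\ge 3$. Then: (1) with $c_0=1$, $c_{d+1}=0$, and $\delta_i=\delta(c_i)+\delta(c_{i+1})$ for $0\le i\le d$, $$\zeta^{\star}(\{2\}^{a_0},c_1,\{2\}^{a_1},\ldots,c_d,\{2\}^{a_d})=-\sum_{k_0\ge k_1\ge\cdots\ge k_d\ge 1}\,\prod_{i=0}^d\frac{(-1)^{k_i\delta_i}}{k_i^{2a_i+3-\delta_i}}\,S^{\sharp}_{k_{i-1},k_i}(\{1\}^{c_i-3});$$ (2) with $c_0=c_{d+1}=1$ and $\delta_i=\delta(c_i)+\delta(c_{i+1})$ for $0\le i\le d$, $$\zeta^{\star}(\{2\}^{a_0},c_1,\{2\}^{a_1},\ldots,c_d,\{2\}^{a_d},1)=\sum_{k_0\ge\cdots\ge k_d\ge 1}\,\prod_{i=0}^d\frac{(-1)^{k_i\delta_i}}{k_i^{2a_i+3-\delta_i}}\,S^{\sharp}_{k_{i-1},k_i}(\{1\}^{c_i-3}).$$ Moreover, if $c_i\in\{1,3\}$, then $S^{\sharp}_{k_{i-1},k_i}(\{1\}^{c_i-3})$ is replaced by $2^{\Delta(k_{i-1},k_i)}$ both in the formula for $\zeta^{\star}(\{2\}^{a_0},c_1,\{2\}^{a_1},\ldots,c_d,\{2\}^{a_d})$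 and in the formula for $\zeta^{\star}(\{2\}^{a_0},c_1,\{2\}^{a_1},\ldots,c_d,\{2\}^{a_d},1)$.
   Context: $\mathbb{N}$ is the set of positive integers. For positive integers $s_1,\ldots,s_m$ with $s_1\ge 2$, $\zeta^\star(s_1,\ldots,s_m)=\sum_{k_1\ge\cdots\ge k_m\ge 1}\frac{1}{k_1^{s_1}\cdots k_m^{s_m}}$ (sum over positive integers), and $\zeta^\star(\emptyset)=1$. $\{s\}^a$ denotes the sequence consisting of $a$ copies of $s$. When $d=0$ the argument strings are $\{2\}^{a_0}$ and $(\{2\}^{a_0},1)$. $\Delta(a,b)=0$ if $a=b$ and $\Delta(a,b)=1$ otherwise. For a string $\mathbf r=(r_1,\ldots,r_c)$ of positive integers and integers $k\ge 0$, $m\ge 1$, the multiple sharp sum is $$S^{\sharp}_{k,m}(r_1,\ldots,r_c)=\sum_{k\ge l_1\ge\cdots\ge l_c\ge m}\frac{2^{\Delta(k,l_1)+\Delta(l_1,l_2)+\cdots+\Delta(l_{c-1},l_c)+\Delta(l_c,m)}}{l_1^{r_1}\cdots l_c^{r_c}}\quad\text{if }\mathbf r\ne\emptyset\text{ and }k\ge m,$$ and $S^{\sharp}_{k,m}(\mathbf r)=2^{\Delta(k,m)}$ if $\mathbf r=\emptyset$ or $k<m$. The string $\{1\}^{c_i-3}$ is empty when $c_i\in\{1,3\}$, so that then $S^{\sharp}_{k_{i-1},k_i}(\{1\}^{c_i-3})=2^{\Delta(k_{i-1},k_i)}$. In all sums the indices are integers. *)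

(* Defs.v *)
From HB Require Import structures.
From mathcomp Require Import all_boot all_order all_algebra.
From mathcomp Require Import all_classical all_reals all_analysis.

Set Implicit Arguments.
Unset Strict Implicit.
Unset Printing Implicit Defensive.

Import Order.TTheory GRing.Theory Num.Theory.

Local Open Scope classical_set_scope.
Local Open Scope ring_scope.

(* The index set [k_1 >= ... >= k_m >= 1] of a multiple sum of depth [m]. *)
Definition chains (m : nat) : set (seq nat) :=
  [set k | size k = m /\ sorted geq (rcons k 1%N)].

(* The value of an absolutely convergent real series over a (countable) index
   set; it is meaningful only under [summable D (EFin \o f)], which is a
   separate claim wherever [abs_sum] is used. *)
Definition abs_sum (R : realType) (T : choiceType) (D : set T) (f : T -> R) :
    \bar R :=
  (\esum_(x in D) (EFin \o f)^\+ x - \esum_(x in D) (EFin \o f)^\- x)%E.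

(* The terms are nonnegative, so the sum always exists in [0, +oo]; in
   particular an equation between it and a real number includes convergence. *)
Definition zeta_star (R : realType) (s : seq nat) : \bar R :=
  \esum_(k in chains (size s))
    (\prod_(i < size s) ((nth 0%N k i)%:R ^+ nth 0%N s i)^-1 : R)%:E.

Definition Delta (a b : nat) : nat := a != b.

(* [path geq k (rcons l m)] says k >= l_1 >= ... >= l_c >= m, and the zipped
   list runs over the pairs (k, l_1), (l_1, l_2), ..., (l_c, m). *)
Definition sharp_sum (R : realType) (k m : nat) (r : seq nat) : R :=
  if (r == [::]) || (k < m)%N then 2 ^+ Delta k m
  else \sum_(t : (size r).-tuple 'I_k.+1
               | path geq k (rcons (map val t) m))
         let l := map val t in
         2 ^+ (\sum_(p <- zip (k :: l) (rcons l m)) Delta p.1 p.2)%N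
         / \prod_(i < size r) (nth 0%N l i)%:R ^+ nth 0%N r i.

(* Only used for c <> 2. *)
Definition delta (c : nat) : nat :=
  if c == 0%N then 2%N else if c == 1%N then 1%N else 0%N.

(* c_0 = 1, c_1, ..., c_d, c_{d+1} = e. *)
Definition c_ext (d : nat) (c : nat -> nat) (e i : nat) : nat :=
  if i == 0%N then 1%N else if i == d.+1 then e else c i.

Definition delta_at (d : nat) (c : nat -> nat) (e i : nat) : nat :=
  (delta (c_ext d c e i) + delta (c_ext d c e i.+1))%N.

(* ({2}^{a_0}, c_1, {2}^{a_1}, ..., c_d, {2}^{a_d}) *)
Definition arg_string (d : nat) (a c : nat -> nat) : seq nat :=
  nseq (a 0%N) 2%N ++ flatten [seq c i :: nseq (a i) 2%N | i <- iota 1 d].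

(* For c < 3 the truncated subtraction makes the string {1}^{c-3} empty. *)
Definition sharp_factor (R : realType) (c k m : nat) : R :=
  sharp_sum R k m (nseq (c - 3) 1%N).

Definition sharp_factor_repl (R : realType) (c k m : nat) : R :=
  if (c == 1%N) || (c == 3%N) then 2 ^+ Delta k m
  else sharp_factor R c k m.

(* The list [k] is k_0, ..., k_d, so that position i of [0 :: k] holds k_{i-1},
   with k_{-1} = 0. The exponent 2 a_i + 3 - delta_i is never truncated: as
   c_i > 0 for i <= d, delta_i <= 3. *)
Definition rhs_term (R : realType) (S : nat -> nat -> nat -> R)
    (d : nat) (a c : nat -> nat) (e : nat) (k : seq nat) : R :=
  \prod_(i < d.+1)
    ((-1) ^+ (nth 0%N k i * delta_at d c e i)
     / (nth 0%N k i)%:R ^+ (2 * a i + 3 - delta_at d c e i)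
     * S (c_ext d c e i) (nth 0%N (0%N :: k) i) (nth 0%N k i)).

(* Main.v *)
Require Import Defs.
From mathcomp Require Import all_boot all_order all_algebra.
From mathcomp Require Import all_classical all_reals all_analysis.
From mathcomp Require Import ring lra zify.
Import Order.TTheory GRing.Theory Num.Theory.
Import numFieldNormedType.Exports.
Local Open Scope classical_set_scope.
Local Open Scope ring_scope.

Set Implicit Arguments.
Unset Strict Implicit.
Unset Printing Implicit Defensive.

(** Both formulas are limits of identities between finite sums. Truncate the
star sum at [n], that is, let its indices run from 1 to [n] ([star]), and put
[w n k = 'C(n, k) / 'C(n + k, k)] ([weight]). For an argument string [s] the
claim is that, for a function [g] independent of [n],

    star s n = \sum_(1 <= k <= n) w n k * g k      for all n >= 1.

Such a [g] ([expands s g]) is built by prepending entries to [s] one at a time.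
Prepending [x] replaces [star s n] by a sum whose increment at [n] is
[star s n / n ^ x], and the weights satisfy
[w n k - w n.-1 k = (k / n) ^ 2 * w n k]; hence the new function is
[h k / k ^ 2] as soon as [h] expands [n ^ 2 / n ^ x * star s n]
([expands_cons]). For [x = 2] take [h = g]. For [x = 1] and [x >= 3] one needs
to absorb a factor [n], respectively [n ^ (2 - x)], into the weights; this is
what the telescoping identities

    n * w n k               = \sum_(k <= j <= n) 2^Delta(j, k) * j * w n j,
    (-1)^k * k * w n k / n  = \sum_(k <= j <= n) 2^Delta(j, k) * (-1)^j * w n j

do ([weight_mul], [weight_div]). The second one, iterated [x - 2] times,
produces the kernel [S^#(1, ..., 1)] with [x - 3] ones, conjugated by the signs
[(-1)^k]. The starting points are the empty string, with [g k = -2 * (-1)^k],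
and the string [1], with [g k = 2 / k].

Read from the left, the resulting [g] for the whole string is, up to the sign
in front of the formula, the sum of the right-hand side over [k_1, ..., k_d] at
fixed [k_0 = k] ([column]). This is proved by induction on [d], shifting the
sequences [a] and [c] ([columnS], [expands_column]): the formula does not change
its shape because its first block always behaves as if preceded by an entry 1
and an index 0.

It remains to let [n] tend to infinity. Each [w n k] lies between 0 and 1
and tends to 1, so dominated convergence gives the theorem once the right-hand side
converges absolutely. The absolute values of its terms are the same expression
with the sign -1 replaced by 1, and [columnS] holds for it as well; by induction
the column sums are [O(sqrt k)], and even [O(sqrt k / k ^ 2)] when the string
starts with an entry at least 2 ([column_bound]). *)

(** * The weights C(n, k) / C(n + k, k) *)

(** This is [n`!^2 / ((n - k)`! (n + k)`!) = 'C(n, k) / 'C(n + k, k)]. As a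
product of ratios it satisfies a one-step recurrence in [k] and visibly vanishes
for [k > n], through the truncated subtraction. *)
Definition weight (R : numFieldType) (n k : nat) : R :=
  \prod_(i < k) ((n - i)%N%:R / (n + i.+1)%N%:R).

Lemma weight0 (R : numFieldType) n : weight R n 0 = 1.
Proof. by rewrite /weight big_ord0. Qed.

Lemma weightS (R : numFieldType) n k :
  weight R n k.+1 = weight R n k * ((n - k)%N%:R / (n + k.+1)%N%:R).
Proof. by rewrite /weight big_ord_recr. Qed.

Lemma weight_small (R : numFieldType) n k : (n < k)%N -> weight R n k = 0.
Proof.
by move=> nk; rewrite /weight (bigD1 (Ordinal nk)) //= subnn mul0r mul0r.
Qed.

Lemma weight_ge0 (R : numFieldType) n k : 0 <= weight R n k.
Proof. by apply: prodr_ge0 => i _; rewrite divr_ge0. Qed.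

Lemma weight_le1 (R : numFieldType) n k : weight R n k <= 1.
Proof.
elim: k => [|k IH]; first by rewrite weight0.
rewrite weightS mulr_ile1 ?weight_ge0 ?divr_ge0//.
by rewrite ler_pdivrMr ?mul1r ?ler_nat ?ltr0n; lia.
Qed.

Lemma weight_step (R : numFieldType) n k :
  n.+1%:R ^+ 2 * weight R n k
  = (n.+1 - k)%N%:R * (n.+1 + k)%N%:R * weight R n.+1 k.
Proof.
elim: k => [|k IH]; first by rewrite !weight0 subn0 addn0 expr2.
rewrite !weightS mulrA IH subSS addnS addSn addnS.
by field; rewrite !(nat1r, =^~ natrD) !pnatr_eq0.
Qed.

(** The increment in [n] of the weight is a multiple of the weight itself, since
[n.+1 ^ 2 - (n.+1 - k) * (n.+1 + k) = k ^ 2]: summing over the largest index of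
a star sum therefore acts termwise on the expansion. *)
Lemma weight_diff (R : numFieldType) n k :
  k%:R ^+ 2 * weight R n.+1 k
  = n.+1%:R ^+ 2 * (weight R n.+1 k - weight R n k).
Proof.
rewrite mulrBr weight_step.
have [kn|nk] := leqP k n.+1; last by rewrite (weight_small _ nk) !mulr0 subrr.
by rewrite (natrB _ kn) natrD; ring.
Qed.

(** Telescoping: [(n - k) * w n k - (n - k.+1) * w n k.+1] equals
[2 * k.+1 * w n k.+1], because [(n - k) * w n k = (n + k.+1) * w n k.+1]. *)
Lemma weight_tail (R : numFieldType) n k : (k <= n)%N ->
  \sum_(k.+1 <= j < n.+1) 2 * j%:R * weight R n j = (n - k)%N%:R * weight R n k.
Proof.
move=> /subnKC; move: (n - k)%N => m; elim: m k => [|m IH] k kn.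
  by rewrite -{1}kn addn0 big_geq// mul0r.
rewrite big_ltn; last by lia.
rewrite IH ?weightS; last by rewrite addSnnS.
have -> : (n - k = m.+1)%N by lia.
rewrite -kn !natrD -!natr1; field.
by rewrite !(natr1, nat1r, =^~ natrD) ?pnatr_eq0; lia.
Qed.

(** The weights are the binomials ['C(2 n, n - k)] divided by ['C(2 n, n)], and
partial alternating sums of a row of Pascal's triangle are binomials of the row
above. *)
Lemma weight_alt_tail (R : numFieldType) n k : (0 < n)%N -> (k <= n)%N ->
  \sum_(k <= j < n.+1) (-1) ^+ j * weight R n j
  = (-1) ^+ k * weight R n k * (n + k)%N%:R / (2 * n%:R).
Proof.
move=> n0 /subnKC; move: (n - k)%N => m; elim: m k => [|m IH] k kn.
  move: kn n0; rewrite addn0 => -> n0; rewrite big_nat1 natrD.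
  by field; rewrite pnatr_eq0 -lt0n.
rewrite big_ltn; last by lia.
rewrite IH ?weightS; last by rewrite addSnnS.
have -> : (n - k = m.+1)%N by lia.
move: n0; rewrite -kn exprS !natrD -!natr1 => n0; field.
by rewrite !(natr1, nat1r, =^~ natrD) ?pnatr_eq0; lia.
Qed.

Lemma sum_Delta (R : numFieldType) (k n : nat) (F : nat -> R) : (k <= n)%N ->
  \sum_(k <= j < n.+1) 2 ^+ Delta j k * F j
  = 2 * \sum_(k <= j < n.+1) F j - F k.
Proof.
move=> kn; rewrite big_ltn// [X in _ = 2 * X - _]big_ltn// /Delta eqxx expr0.
rewrite mul1r mulrDr big_distrr/=.
rewrite (eq_big_nat _ _ (F2 := fun j => 2 * F j)); first by ring.
by move=> j /andP[kj _]; rewrite gtn_eqF// expr1.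
Qed.

(** Absorbs a factor [n] into the weights; used to prepend an entry 1. *)
Lemma weight_mul (R : numFieldType) n k : (k <= n)%N ->
  n%:R * weight R n k
  = \sum_(k <= j < n.+1) 2 ^+ Delta j k * (j%:R * weight R n j).
Proof.
move=> kn; rewrite sum_Delta// big_ltn// mulrDr big_distrr/=.
under eq_bigr do rewrite mulrA.
by rewrite weight_tail// (natrB _ kn); ring.
Qed.

(** Absorbs a factor [1 / n] into the weights; used to prepend an entry at least
3. At [k = 0] it expands the constant 1. *)
Lemma weight_div (R : numFieldType) n k : (0 < n)%N -> (k <= n)%N ->
  (-1) ^+ k * k%:R * weight R n k / n%:R
  = \sum_(k <= j < n.+1) 2 ^+ Delta j k * ((-1) ^+ j * weight R n j).
Proof.
move=> n0 kn; rewrite sum_Delta// weight_alt_tail// natrD.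
by field; rewrite pnatr_eq0 -lt0n.
Qed.

Lemma triangular_exchange (V : nmodType) (n : nat) (F : nat -> nat -> V) :
  \sum_(1 <= k < n.+1) \sum_(k <= j < n.+1) F j k
  = \sum_(1 <= j < n.+1) \sum_(1 <= k < j.+1) F j k.
Proof.
elim: n => [|n IH]; first by rewrite !big_geq.
rewrite big_nat_recr//= [RHS]big_nat_recr//= -IH big_nat1.
rewrite [X in _ = _ + X]big_nat_recr//= addrA -big_split/=; congr (_ + _).
by apply: eq_big_nat => k /andP[_ kn]; rewrite big_nat_recr// ltnW.
Qed.

(** * Expansions of truncated star sums *)

Fixpoint star (R : numFieldType) (s : seq nat) (n : nat) : R :=
  if s is x :: s' then \sum_(1 <= k < n.+1) (k%:R ^+ x)^-1 * star R s' k else 1.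

Definition expands (R : numFieldType) (s : seq nat) (g : nat -> R) :=
  forall n, (0 < n)%N ->
    star R s n = \sum_(1 <= k < n.+1) weight R n k * g k.

(** The engine of the finite identity: by [weight_diff], dividing the
coefficients by [k ^ 2] and summing over the truncation is the same as dividing the sum by
[n ^ 2]. *)
Lemma expands_cons (R : numFieldType) (s : seq nat) (x : nat) (h : nat -> R) :
  (forall n, (0 < n)%N -> n%:R ^+ 2 / n%:R ^+ x * star R s n
     = \sum_(1 <= k < n.+1) weight R n k * h k) ->
  expands (x :: s) (fun k => h k / k%:R ^+ 2).
Proof.
move=> sh n _; elim: n => [|n IH]; first by rewrite /= !big_geq.
rewrite /= big_nat_recr//=; move: IH => /= ->.
have n0 : n.+1%:R != 0 :> R by rewrite pnatr_eq0.
have -> : (n.+1%:R ^+ x)^-1 * star R s n.+1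
    = n.+1%:R ^- 2 * (n.+1%:R ^+ 2 / n.+1%:R ^+ x * star R s n.+1).
  by rewrite -mulrA mulKf// expf_neq0.
rewrite sh// big_distrr/= (big_nat_recr n.+1)//= [RHS]big_nat_recr//= addrA.
rewrite -big_split/=; congr (_ + _).
  (* The difference of the two sides is a multiple of the identity [e]. *)
  apply: eq_big_nat => k /andP[k0 _].
  have k0' : k%:R != 0 :> R by rewrite pnatr_eq0 -lt0n.
  have /eqP := weight_diff R n k; rewrite -subr_eq0 => /eqP e.
  apply/eqP; rewrite -subr_eq0 -(mulr0 (h k / (k%:R ^+ 2 * n.+1%:R ^+ 2))) -e.
  by apply/eqP; move: n.+1%:R n0 => N n0; field; rewrite n0 k0'.
by ring.
Qed.

Lemma eq_expands (R : numFieldType) (s : seq nat) (g h : nat -> R) :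
  (forall k, (0 < k)%N -> g k = h k) -> expands s g -> expands s h.
Proof.
move=> gh sg n n0; rewrite sg//.
by apply: eq_big_nat => k /andP[k0 _]; rewrite gh.
Qed.

Lemma expands_nil (R : numFieldType) :
  expands [::] (fun k => - 2 * (-1) ^+ k : R).
Proof.
move=> n n0 /=; have := weight_div R n0 (leq0n n).
rewrite !(mulr0, mul0r) [in RHS]big_ltn//= mul1r expr0 mul1r weight0.
move=> /esym/eqP; rewrite addr_eq0 => /eqP {1}->.
rewrite -sumrN; apply: eq_big_nat => k /andP[k0 _].
by rewrite /Delta gtn_eqF// expr1; ring.
Qed.

Lemma expands_cons2 (R : numFieldType) (s : seq nat) (g : nat -> R) :
  expands s g -> expands (2%N :: s) (fun k => g k / k%:R ^+ 2).
Proof.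
move=> sg; apply: expands_cons => n n0; rewrite sg// divff ?mul1r//.
by rewrite expf_neq0// pnatr_eq0 -lt0n.
Qed.

Lemma expands_cons1 (R : numFieldType) (s : seq nat) (g : nat -> R) :
  expands s g ->
  expands (1%N :: s)
    (fun k => (\sum_(1 <= j < k.+1) 2 ^+ Delta k j * g j) / k%:R).
Proof.
move=> sg; pose h k := k%:R * \sum_(1 <= j < k.+1) 2 ^+ Delta k j * g j.
apply: (@eq_expands _ _ (fun k => h k / k%:R ^+ 2)).
  by move=> k k0; rewrite /h; field; rewrite pnatr_eq0 -lt0n.
apply: expands_cons => n n0; rewrite sg//.
have -> : n%:R ^+ 2 / n%:R ^+ 1 = n%:R :> R.
  by field; rewrite pnatr_eq0 -lt0n.
rewrite big_distrr/=.
under eq_big_nat => k /andP[_ kn].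
  rewrite mulrA weight_mul// big_distrl/=; over.
rewrite triangular_exchange; apply: eq_bigr => k _.
rewrite /h !big_distrr/=; apply: eq_bigr => j _; ring.
Qed.

(** The multiple sharp sum at [r] ones, in recursive form. Its value is 0 for
[k < m], where the convention for sharp sums gives 2: with this choice inner
ranges of summation need no lower bound. *)
Fixpoint sharp (R : numFieldType) (r k m : nat) : R :=
  if r is r'.+1 then
    \sum_(1 <= l < k.+1) 2 ^+ Delta k l / l%:R * sharp R r' l m
  else if (m <= k)%N then 2 ^+ Delta k m else 0.

Lemma sharp_small (R : numFieldType) r k m : (k < m)%N -> sharp R r k m = 0.
Proof.
elim: r k => [|r IH] k km /=; first by rewrite leqNgt km.
by rewrite big_nat big1// => l /andP[_ lk]; rewrite IH ?mulr0//; lia.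
Qed.

Lemma sum_sharpS (R : numFieldType) r k (f : nat -> R) :
  \sum_(1 <= j < k.+1) sharp R r.+1 k j * f j
  = \sum_(1 <= l < k.+1) 2 ^+ Delta k l / l%:R
      * \sum_(1 <= j < l.+1) sharp R r l j * f j.
Proof.
under eq_bigr do rewrite /= big_distrl/=.
rewrite exchange_big/=; apply: eq_big_nat => l /andP[_ lk].
rewrite big_distrr/= [LHS](big_cat_nat _ (n := l.+1))//=.
rewrite [X in _ + X]big_nat [X in _ + X]big1 => [|j /andP[lj _]].
  by rewrite addr0; apply: eq_bigr => j _; rewrite mulrA.
by rewrite sharp_small// mulr0 mul0r.
Qed.

(** Iterating [weight_div]. Each step multiplies the coefficients by
[(-1)^k M (-1)^k k^-1], where [M] has the matrix [2^Delta]; the signs between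
consecutive steps cancel, so only the outermost ones remain. *)
Lemma weight_iter_div (R : numFieldType) r n (g : nat -> R) : (0 < n)%N ->
  n%:R ^- r.+1 * \sum_(1 <= k < n.+1) weight R n k * g k
  = \sum_(1 <= k < n.+1) weight R n k * ((-1) ^+ k *
      \sum_(1 <= j < k.+1) sharp R r k j * ((-1) ^+ j / j%:R * g j)).
Proof.
move=> n0.
have once (f : nat -> R) :
    n%:R^-1 * (\sum_(1 <= k < n.+1) weight R n k * ((-1) ^+ k * (k%:R * f k)))
    = \sum_(1 <= k < n.+1) weight R n k * ((-1) ^+ k *
        \sum_(1 <= j < k.+1) 2 ^+ Delta k j * f j).
  rewrite big_distrr/=.
  under eq_big_nat => k /andP[_ kn].
    have -> : n%:R^-1 * (weight R n k * ((-1) ^+ k * (k%:R * f k)))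
        = ((-1) ^+ k * k%:R * weight R n k / n%:R) * f k by ring.
    rewrite weight_div// big_distrl/=; over.
  rewrite triangular_exchange; apply: eq_bigr => k _.
  by rewrite !big_distrr/=; apply: eq_bigr => j _; ring.
elim: r => [|r IH].
  pose f k := (-1) ^+ k / k%:R * g k.
  under eq_big_nat => k /andP[k0 _].
    have -> : g k = (-1) ^+ k * (k%:R * f k).
      rewrite /f -!mulrA (mulrCA k%:R) mulVKf ?pnatr_eq0 -?lt0n//.
      by rewrite mulrA -expr2 sqrr_sign mul1r.
    over.
  rewrite expr1 once; apply: eq_bigr => k _; do 2 congr (_ * _).
  by apply: eq_big_nat => j /andP[_ jk] /=; rewrite -ltnS jk.
have -> : n%:R ^- r.+2 = n%:R^-1 * n%:R ^- r.+1 :> R.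
  by rewrite -exprVn exprS exprVn.
rewrite -mulrA IH.
under eq_big_nat => k /andP[k0 _].
  rewrite -[X in (-1) ^+ k * X](@mulKf _ k%:R) ?pnatr_eq0 -?lt0n//.
  rewrite (mulrCA k%:R^-1); over.
rewrite once; apply: eq_bigr => k _; rewrite sum_sharpS; do 2 congr (_ * _).
by apply: eq_bigr => l _; rewrite mulrA.
Qed.

Lemma expands_cons_ge3 (R : numFieldType) (s : seq nat) (x : nat)
    (g : nat -> R) : (3 <= x)%N -> expands s g ->
  expands (x :: s) (fun k => (-1) ^+ k * (\sum_(1 <= j < k.+1)
    sharp R (x - 3) k j * ((-1) ^+ j / j%:R * g j)) / k%:R ^+ 2).
Proof.
move=> x3 sg; apply: expands_cons => n n0; rewrite sg// -weight_iter_div//.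
have -> : x = (2 + (x - 3).+1)%N by lia.
have -> : (2 + (x - 3).+1 - 3 = x - 3)%N by lia.
rewrite exprD; congr (_ * _); field.
by rewrite !expf_neq0 ?pnatr_eq0 -?lt0n.
Qed.

(** * Multiple sums *)

(** The chains with largest index at most [n], as an explicit list, which turns
the truncated multiple sums into iterated sums. *)
Fixpoint bounded_chains (m n : nat) : seq (seq nat) :=
  if m is m'.+1 then
    [seq k :: l | k <- index_iota 1 n.+1, l <- bounded_chains m' k]
  else [:: [::]].

Lemma sum_bounded_chainsS (V : nmodType) m n (f : seq nat -> V) :
  \sum_(l <- bounded_chains m.+1 n) f l
  = \sum_(1 <= k < n.+1) \sum_(l <- bounded_chains m k) f (k :: l).
Proof. exact: big_allpairs_dep. Qed.

(** This is what makes [zeta_star] a limit of the sums [star]. *)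
Lemma star_bounded_chains (R : numFieldType) s n :
  star R s n = \sum_(l <- bounded_chains (size s) n)
    \prod_(i < size s) ((nth 0%N l i)%:R ^+ nth 0%N s i)^-1.
Proof.
elim: s n => [|x s IH] n; first by rewrite /= big_seq1 big_ord0.
rewrite [size _]/= sum_bounded_chainsS /=; apply: eq_bigr => k _.
by rewrite IH big_distrr/=; apply: eq_bigr => l _; rewrite big_ord_recl.
Qed.

(** * Sharp sums *)

Lemma sum_tupleS (V : nmodType) (T : finType) r (P : pred (seq T))
    (F : seq T -> V) :
  \sum_(t : r.+1.-tuple T | P t) F t
  = \sum_(x : T) \sum_(t : r.-tuple T | P (x :: t)) F (x :: t).
Proof.
rewrite pair_big_dep/=.
rewrite (reindex (fun p : T * r.-tuple T => cons_tuple p.1 p.2))/=.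
  by apply: eq_big => [[x t]|[x t]].
exists (fun t => (thead t, behead_tuple t)) => [[x t] _|t _] /=.
  by congr (_, _); apply: val_inj.
by rewrite [RHS]tuple_eta; apply: val_inj.
Qed.

(** The tuples range over a fixed ['I_K.+1], rather than ['I_k.+1], because [k]
decreases along the induction while the type of the entries must not change. *)
Lemma sum_tuple_sharp (R : numFieldType) r K k m : (k <= K)%N -> (0 < m)%N ->
  \sum_(t : r.-tuple 'I_K.+1 | path geq k (rcons (map val t) m))
    2 ^+ (\sum_(p <- zip (k :: map val t) (rcons (map val t) m))
            Delta p.1 p.2)%N
    / \prod_(i < r) (nth 0%N (map val t) i)%:R
  = sharp R r k m.
Proof.
move=> kK m0; elim: r k kK => [|r IH] k kK.
  rewrite /= (eq_bigl (fun=> (m <= k)%N)); last first.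
    by move=> t; rewrite tuple0 /= andbT.
  case: leqP => km; last by rewrite big_pred0.
  rewrite (eq_bigr (fun=> 2 ^+ Delta k m)) ?sumr_const.
    by rewrite card_tuple expn0 mulr1n.
  by move=> t _; rewrite tuple0 /= big_seq1 big_ord0 divr1.
rewrite (sum_tupleS r (fun t => path geq k (rcons (map val t) m))
  (fun t => 2 ^+ (\sum_(p <- zip (k :: map val t) (rcons (map val t) m))
            Delta p.1 p.2)%N
    / \prod_(i < r.+1) (nth 0%N (map val t) i)%:R)).
pose G l := 2 ^+ Delta k l / l%:R * sharp R r l m.
transitivity (\sum_(l < K.+1 | (l < k.+1)%N) G l).
  rewrite [RHS]big_mkcond; apply: eq_bigr => x _ /=; rewrite ltnS.
  have [xk|kx] := leqP x k; last by rewrite big1// => t /andP[]; lia.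
  rewrite /G -IH ?(leq_trans xk)// big_distrr/=; apply: eq_bigr => t _.
  by rewrite big_cons exprD big_ord_recl/= invfM; ring.
(* The index 0 contributes nothing, since [m] is positive. *)
rewrite -big_ord_widen// -(big_mkord predT G) big_ltn//.
by rewrite /G sharp_small// mulr0 add0r.
Qed.

Lemma sharp_factorE (R : realType) c k m : (0 < m)%N -> (m <= k)%N ->
  sharp_factor R c k m = sharp R (c - 3) k m.
Proof.
move=> m0 mk; rewrite /sharp_factor /sharp_sum.
case: (c - 3)%N => [|r]; first by rewrite /= mk.
rewrite -(sum_tuple_sharp R r.+1 (leqnn k) m0) ltnNge mk size_nseq /=.
apply: eq_bigr => t _; congr (_ / _); apply: eq_bigr => i _.
by rewrite -[1%N :: _]/(nseq r.+1 1%N) nth_nseq ltn_ord expr1.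
Qed.

Lemma sharp_factor0 (R : realType) m : (0 < m)%N -> sharp_factor R 1 0 m = 2.
Proof. by case: m. Qed.

Lemma sharp_factor_replE (R : realType) :
  @sharp_factor_repl R = @sharp_factor R.
Proof.
apply/funext => c; apply/funext => k; apply/funext => m.
rewrite /sharp_factor_repl.
by have [->|_] := eqVneq c 1%N => //; have [->|_] := eqVneq c 3%N.
Qed.

Lemma sharp_ge0 (R : numFieldType) r k m : 0 <= sharp R r k m.
Proof.
elim: r k => [|r IH] k /=; first by case: ifP => // _; rewrite exprn_ge0.
by apply: sumr_ge0 => l _; rewrite mulr_ge0// divr_ge0// exprn_ge0.
Qed.

Lemma sharp_factor_ge0 (R : realType) c k m : 0 <= sharp_factor R c k m.
Proof.
rewrite /sharp_factor /sharp_sum; case: ifP => _; first by rewrite exprn_ge0.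
by apply: sumr_ge0 => t _; rewrite divr_ge0 ?exprn_ge0// prodr_ge0.
Qed.

(** * Column sums *)

(** The sign -1 is a parameter [z]: the value [z = -1] gives the terms of the
formula and [z = 1] their absolute values, and the recursion [columnS] is proved
for both at once. *)
Definition signed_term (R : realType) (z : R) (d : nat) (a c : nat -> nat)
    (e : nat) (k : seq nat) : R :=
  \prod_(i < d.+1)
    (z ^+ (nth 0%N k i * delta_at d c e i)
     / (nth 0%N k i)%:R ^+ (2 * a i + 3 - delta_at d c e i)
     * sharp_factor R (c_ext d c e i) (nth 0%N (0%N :: k) i) (nth 0%N k i)).

Definition column (R : realType) (z : R) (d : nat) (a c : nat -> nat)
    (e k : nat) : R :=
  \sum_(l <- bounded_chains d k) signed_term z d a c e (k :: l).

Lemma delta_le2 c : (delta c <= 2)%N.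
Proof. by rewrite /delta; case: ifP => // _; case: ifP. Qed.

Lemma column0 (R : realType) (z : R) a c e k : (0 < k)%N ->
  column z 0 a c e k
  = 2 * z ^+ (k * (delta e).+1) / k%:R ^+ (2 * a 0%N + 2 - delta e).
Proof.
move=> k0; rewrite /column big_seq1 /signed_term big_ord1 /= /delta_at /c_ext/=.
by rewrite sharp_factor0// add1n !addnS !subSS mulrC mulrA.
Qed.

(** The first link of the chain is split off. What is left is a column for the
shifted data, because the factor 2 and the exponents at its first index are
those of a string preceded by an entry 1, up to the powers of [z] and [j] that
stand in the sum. *)
Lemma columnS (R : realType) (z : R) d a c e k : z ^+ 2 = 1 ->
  (0 < c 1%N)%N -> (0 < k)%N ->
  column z d.+1 a c e k
  = z ^+ (k * (delta (c 1%N)).+1) / k%:R ^+ (2 * a 0%N + 2 - delta (c 1%N))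
    * \sum_(1 <= j < k.+1) sharp R (c 1%N - 3) k j
      * (z ^+ (j * (delta (c 1%N)).+1) / j%:R ^+ (1 - delta (c 1%N))
         * column z d (a \o S) (c \o S) e j).
Proof.
move=> z2 c0 k0; rewrite /column sum_bounded_chainsS big_distrr/=.
apply: eq_big_nat => j /andP[j0]; rewrite ltnS => jk.
rewrite !big_distrr/=; apply: eq_bigr => l _.
rewrite /signed_term big_ord_recl big_ord_recl [in RHS]big_ord_recl.
set P := (X in _ * (_ * X) = _); set Q := (X in _ = _ * (_ * (_ * (_ * X)))).
have -> : P = Q by [].
rewrite /= /delta_at /c_ext /=.
rewrite !sharp_factor0// sharp_factorE//.
set D := delta (c 1%N); set E := delta (if _ then _ else _).
have D1 : (D <= 1)%N by rewrite /D /delta gtn_eqF//; case: ifP.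
have E2 : (E <= 2)%N by exact: delta_le2.
have -> : delta 1 = 1%N by [].
have -> : (2 * a 0 + 3 - (1 + D) = 2 * a 0 + 2 - D)%N by lia.
have -> : (2 * a 1 + 3 - (D + E) = (1 - D) + (2 * a 1 + 3 - (1 + E)))%N by lia.
have -> : z ^+ (j * (D + E)) = z ^+ (j * D.+1) * z ^+ (j * (1 + E)).
  rewrite -exprD; have -> : (j * D.+1 + j * (1 + E) = 2 * j + j * (D + E))%N.
    by rewrite !mulnDr mulnS muln1; lia.
  by rewrite [RHS]exprD [z ^+ (2 * j)]exprM z2 expr1n mul1r.
by rewrite exprD invfM add1n; ring.
Qed.

(** * The finite identity *)

Lemma arg_stringS d a c :
  arg_string d.+1 a c
  = nseq (a 0%N) 2%N ++ c 1%N :: arg_string d (a \o S) (c \o S).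
Proof.
rewrite /arg_string [iota 1 d.+1]/= (iotaDl 1 1 d) map_cons -map_comp.
by [].
Qed.

Lemma expands_twos (R : numFieldType) s (g : nat -> R) m :
  expands s g -> expands (nseq m 2%N ++ s) (fun k => g k / k%:R ^+ (2 * m)).
Proof.
move=> sg; elim: m => [|m IH].
  by apply: (eq_expands _ sg) => k _; rewrite muln0 divr1.
apply: (@eq_expands _ _ (fun k => g k / k%:R ^+ (2 * m) / k%:R ^+ 2));
  last exact (expands_cons2 IH).
by move=> k _; rewrite mulnS addnC exprD [in RHS]invfM mulrA.
Qed.

(** [weight_tail] at [k = 0] expands [n], hence the harmonic numbers. *)
Lemma expands_one (R : numFieldType) : expands [:: 1%N] (fun k => 2 / k%:R : R).
Proof.
apply: (@eq_expands _ _ (fun k => 2 * k%:R / k%:R ^+ 2)).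
  by move=> k k0; field; rewrite pnatr_eq0 -lt0n.
apply: expands_cons => n n0; rewrite mulr1.
under eq_bigr do rewrite mulrC.
rewrite weight_tail// subn0 weight0; field.
by rewrite pnatr_eq0 -lt0n.
Qed.

Lemma sign_double (R : pzRingType) k : (-1) ^+ (k * 2) = 1 :> R.
Proof. by rewrite mulnC exprM sqrrN !expr1n. Qed.

(** The finite form of both formulas. The strings may start with 1, as do
the suffixes that the induction meets. *)
Lemma expands_column (R : realType) d a c e : (e <= 1)%N ->
  (forall i, (1 <= i <= d)%N -> (0 < c i)%N /\ c i <> 2%N) ->
  expands (arg_string d a c ++ nseq e 1%N)
    (fun k => (-1) ^+ e.+1 * column (-1) d a c e k : R).
Proof.
move=> e1; elim: d a c => [|d IH] a c hc.
  rewrite /arg_string/= cats0.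
  case: e e1 => [|[|//]] _.
    apply: (eq_expands _ (expands_twos (a 0%N) (@expands_nil R))) => k k0.
    rewrite column0// addnK expr1 (_ : (k * 3 = k * 2 + k)%N); last by lia.
    by rewrite exprD sign_double; ring.
  apply: (eq_expands _ (expands_twos (a 0%N) (@expands_one R))) => k k0.
  rewrite column0// /delta/= sign_double addn2 subSS subn0 [k%:R ^+ _.+1]exprS.
  by rewrite [in RHS]invfM; ring.
have [c0 c2] := hc 1%N isT.
have sg : expands (arg_string d (a \o S) (c \o S) ++ nseq e 1%N)
    (fun k => (-1) ^+ e.+1 * column (-1) d (a \o S) (c \o S) e k : R).
  by apply: IH => i hi; apply: (hc i.+1); lia.
rewrite arg_stringS -catA cat_cons.
have [c1|c3] : c 1%N = 1%N \/ (3 <= c 1%N)%N by lia.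
  apply: eq_expands (expands_twos (a 0%N) _); last first.
    rewrite c1; exact (expands_cons1 sg).
  move=> k k0 /=; rewrite columnS ?sqrrN ?expr1n// c1 /delta/=.
  rewrite sign_double addn2 subSS subn0 [k%:R ^+ _.+1]exprS.
  under eq_bigr do rewrite mulrCA.
  rewrite -big_distrr/= [in RHS]invfM.
  rewrite [X in _ = _ * (_ * X)](_ : _ =
    \sum_(1 <= j < k.+1) 2 ^+ Delta k j * column (-1) d (a \o S) (c \o S) e j).
    by ring.
  apply: eq_big_nat => j /andP[_ jk].
  by rewrite -ltnS jk sign_double subnn expr0 divr1 mul1r.
apply: eq_expands (expands_twos (a 0%N) _); last first.
  exact (expands_cons_ge3 c3 sg).
move=> k k0 /=; rewrite columnS ?sqrrN ?expr1n//.
have -> : delta (c 1%N) = 0%N by rewrite /delta; case: (c 1%N) c3 => [|[|]].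
rewrite !muln1 !subn0 exprD [in RHS]invfM.
have flip (p q r t : R) : p * (q * (r * t)) = r * (p * (q * t)) by ring.
under eq_bigr do rewrite flip.
rewrite -big_distrr/=.
rewrite [X in _ = _ * (_ * X)](_ : _ =
  \sum_(1 <= j < k.+1) sharp R (c 1%N - 3) k j *
    ((-1) ^+ j / j%:R * column (-1) d (a \o S) (c \o S) e j)).
  by ring.
by apply: eq_bigr => j _; rewrite muln1.
Qed.

(** * Absolute convergence *)

Lemma signed_term1 (R : realType) d a c e k :
  signed_term (1 : R) d a c e k = `|signed_term (-1 : R) d a c e k|.
Proof.
rewrite /signed_term normr_prod; apply: eq_bigr => i _.
rewrite !normrM normfV !normrX normrN normr1 normr_nat.
by rewrite [X in _ = _ * X]ger0_norm ?sharp_factor_ge0.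
Qed.

Lemma column1_ge0 (R : realType) d a c e k : 0 <= column (1 : R) d a c e k.
Proof. by apply: sumr_ge0 => l _; rewrite signed_term1. Qed.

(** Since [y ^ 2 = x ^ 2 + 1], one has [2 * (y - x) * y ^ 2 >= y]; both sums below
are bounded by telescoping with this inequality. *)
Lemma sqrt_succ_gap (R : realType) n :
  let x := Num.sqrt n%:R : R in let y := Num.sqrt n.+1%:R : R in
  [/\ 0 <= x, 0 < y, y ^+ 2 = n.+1%:R &
      2 * (y - x) * y ^+ 2 = y + y * (y - x) ^+ 2].
Proof.
move=> x y.
have x2 : x ^+ 2 = n%:R by rewrite sqr_sqrtr.
have y2 : y ^+ 2 = n.+1%:R by rewrite sqr_sqrtr.
split => //; rewrite ?sqrtr_ge0 ?sqrtr_gt0 ?ltr0n//.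
have e : y ^+ 2 = x ^+ 2 + 1 by rewrite x2 y2 natr1.
apply/eqP; rewrite -subr_eq0; apply/eqP.
transitivity (y * (y ^+ 2 - (x ^+ 2 + 1))); first by ring.
by rewrite e subrr mulr0.
Qed.

Lemma sum_inv_sqrt (R : realType) k :
  \sum_(1 <= l < k.+1) Num.sqrt l%:R / l%:R <= 2 * Num.sqrt k%:R :> R.
Proof.
elim: k => [|k IH]; first by rewrite big_geq// sqrtr0 mulr0.
rewrite big_nat_recr//=; have [x0 y0 y2 e] := sqrt_succ_gap R k.
rewrite -[leRHS](subrK (2 * Num.sqrt k%:R)) addrC lerD//.
rewrite -mulrBr -{2}y2 ler_pdivrMr ?exprn_gt0// e lerDl.
by rewrite mulr_ge0 ?sqr_ge0 ?ltW.
Qed.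

Lemma sum_sqrt_sqr (R : realType) n :
  \sum_(1 <= k < n.+1) Num.sqrt k%:R / k%:R ^+ 2 <= 3 :> R.
Proof.
case: n => [|n]; first by rewrite big_geq.
apply: (@le_trans _ _ (3 - 2 / Num.sqrt n.+1%:R)); last first.
  by rewrite gerBl divr_ge0 ?sqrtr_ge0.
elim: n => [|n IH]; first by rewrite big_nat1 sqrtr1 expr1n !divr1; lra.
rewrite big_nat_recr//=; apply: (le_trans (lerD IH (lexx _))).
have [x0 y0 y2 e] := sqrt_succ_gap R n.+1.
have {}x0 : 0 < Num.sqrt n.+1%:R :> R by rewrite sqrtr_gt0 ltr0n.
move: x0 y0 y2 e; set x := Num.sqrt n.+1%:R; set y := Num.sqrt _.
move=> x0 y0 <- e.
have -> : y / (y ^+ 2) ^+ 2 = y ^- 3.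
  by field; rewrite gt_eqF.
suff : y ^- 3 <= 2 / x - 2 / y by lra.
have -> : 2 / x - 2 / y = 2 * (y - x) * y ^+ 2 / (x * y ^+ 3).
  by field; rewrite !gt_eqF.
rewrite e ler_pdivlMr ?mulr_gt0 ?exprn_gt0// mulrC mulfK ?gt_eqF ?exprn_gt0//.
have : x <= y by rewrite ler_wsqrtr// ler_nat.
have := mulr_ge0 (ltW y0) (sqr_ge0 (y - x)); lra.
Qed.

Lemma Delta_le2 (R : numFieldType) k l : 2 ^+ Delta k l <= 2 :> R.
Proof. by rewrite /Delta; case: (_ != _); rewrite ?expr1// expr0 ler1n. Qed.

(** The class of functions [O(sqrt k)] absorbs the logarithms that sharp sums
produce: it is stable under [f |-> \sum_(j <= k) f j / j]. *)
Lemma sharp_sqrt_bound (R : realType) r : exists2 C : R, 0 <= C & forall k,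
  \sum_(1 <= j < k.+1) sharp R r k j * (Num.sqrt j%:R / j%:R)
  <= C * Num.sqrt k%:R.
Proof.
elim: r => [|r [C C0 IH]].
  exists 4 => // k; apply: (@le_trans _ _ (2 * (2 * Num.sqrt k%:R))); last lra.
  apply: le_trans (ler_wpM2l _ (sum_inv_sqrt R k)) => //.
  rewrite big_distrr/=; apply: ler_sum_nat => j /andP[_ jk].
  by rewrite -ltnS jk ler_wpM2r ?Delta_le2.
exists (4 * C) => [|k]; first by rewrite mulr_ge0.
rewrite sum_sharpS.
apply: (@le_trans _ _ (2 * C * (2 * Num.sqrt k%:R))); last lra.
apply: le_trans (ler_wpM2l _ (sum_inv_sqrt R k)); last by rewrite mulr_ge0.
rewrite big_distrr/=; apply: ler_sum_nat => l _.
apply: (@le_trans _ _ (2 ^+ Delta k l / l%:R * (C * Num.sqrt l%:R))).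
  by rewrite ler_wpM2l// divr_ge0 ?exprn_ge0.
rewrite [leLHS](_ : _ = 2 ^+ Delta k l * (C * (Num.sqrt l%:R / l%:R))).
  by rewrite -[leRHS]mulrA ler_wpM2r ?Delta_le2// mulr_ge0.
by ring.
Qed.

(** All steps of [columnS] preserve the bound [O(sqrt k)], whatever the entry:
an entry 1 averages the previous column, and an entry at least 3 applies a sharp
kernel to [column j / j]. The extra powers of [k] come from the leading entries 2,
and from the factor [k ^ -2] of a leading entry at least 3. *)
Lemma column_bound (R : realType) d a c e : (e <= 1)%N ->
  (forall i, (1 <= i <= d)%N -> (0 < c i)%N /\ c i <> 2%N) ->
  exists2 C : R, 0 <= C & forall k, (0 < k)%N ->
    k%:R ^+ (2 * a 0%N + (if (0 < d)%N && (3 <= c 1%N)%N then 2 else 0))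
      * column 1 d a c e k <= C * Num.sqrt k%:R.
Proof.
move=> e1; elim: d a c => [|d IH] a c hc.
  exists 2 => // k k0; rewrite column0// expr1n mulr1 addn0.
  have k1 : 1 <= k%:R :> R by rewrite ler1n.
  apply: (@le_trans _ _ 2); last first.
    by rewrite ler_peMr// -[leLHS]sqrtr1 ler_wsqrtr.
  rewrite mulrCA -[leRHS]mulr1 ler_wpM2l// ler_pdivrMr ?exprn_gt0 ?ltr0n//.
  rewrite mul1r ler_weXn2l//.
  by case: e e1 => [|[|]]//; rewrite /delta/=; lia.
have [c0 c2] := hc 1%N isT.
have [C C0 hC] : exists2 C : R, 0 <= C & forall k, (0 < k)%N ->
    column 1 d (a \o S) (c \o S) e k <= C * Num.sqrt k%:R.
  have [|C C0 hC] := IH (a \o S) (c \o S).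
    by move=> i hi; apply: (hc i.+1); lia.
  exists C => // k k0; apply: le_trans (hC k k0).
  by rewrite ler_peMl ?column1_ge0// exprn_ege1// ler1n.
have [c1|c3] : c 1%N = 1%N \/ (3 <= c 1%N)%N by lia.
  exists (2 * C) => [|k k0]; first by rewrite mulr_ge0.
  rewrite columnS ?expr1n// c1 /delta/= addn0 addn2 subSS subn0.
  rewrite [k%:R ^+ _.+1]exprS mul1r invfM mulrA.
  have kn0 : k%:R != 0 :> R by rewrite pnatr_eq0 -lt0n.
  rewrite mulrCA mulfV ?mulr1 ?expf_neq0//.
  rewrite mulrC ler_pdivrMr ?ltr0n//.
  apply: (@le_trans _ _ (\sum_(1 <= j < k.+1) 2 * C * Num.sqrt k%:R)).
    apply: ler_sum_nat => j /andP[j0 jk].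
    rewrite -ltnS jk subnn expr0 !expr1n divr1 mul1r -mulrA.
    rewrite ler_pM ?exprn_ge0 ?column1_ge0 ?Delta_le2//.
    apply: le_trans (hC j j0) _; rewrite ler_wpM2l// ler_wsqrtr// ler_nat.
    by rewrite -ltnS.
  by rewrite sumr_const_nat subn1 [leRHS]mulr_natr.
have [D D0 hD] := sharp_sqrt_bound R (c 1%N - 3).
exists (C * D) => [|k k0]; first by rewrite mulr_ge0.
rewrite columnS ?expr1n// c3.
have -> : delta (c 1%N) = 0%N by rewrite /delta; case: (c 1%N) c3 => [|[|]].
have kn0 : k%:R != 0 :> R by rewrite pnatr_eq0 -lt0n.
rewrite subn0 mulrA mul1r mulfV ?expf_neq0// mul1r -mulrA.
apply: le_trans (ler_wpM2l C0 (hD k)); rewrite big_distrr/=.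
apply: ler_sum_nat => j /andP[j0 _]; rewrite expr1n subn0 expr1.
rewrite [leRHS]mulrCA ler_wpM2l ?sharp_ge0// mul1r mulrC mulrA.
by rewrite ler_wpM2r ?invr_ge0// hC.
Qed.

Lemma sum_abs_bound (R : realType) d a c e : (e <= 1)%N ->
  (forall i, (1 <= i <= d)%N -> (0 < c i)%N /\ c i <> 2%N) ->
  (a 0%N = 0%N -> (1 <= d)%N -> (3 <= c 1%N)%N) ->
  (d = 0%N -> (1 <= a 0%N)%N) ->
  exists B : R, forall n, \sum_(l <- bounded_chains d.+1 n)
    `|signed_term (-1 : R) d a c e l| <= B.
Proof.
move=> e1 hc hc1 ha0; have [C C0 hC] := column_bound R a e1 hc.
exists (C * 3) => n; rewrite sum_bounded_chainsS.
apply: le_trans (ler_wpM2l C0 (sum_sqrt_sqr R n)); rewrite big_distrr/=.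
apply: ler_sum_nat => k /andP[k0 _].
under eq_bigr do rewrite -signed_term1.
rewrite -[leLHS]/(column 1 d a c e k) mulrA ler_pdivlMr ?exprn_gt0 ?ltr0n//.
apply: le_trans (hC k k0); rewrite mulrC ler_wpM2r ?column1_ge0//.
rewrite ler_weXn2l ?ler1n//.
by case: (a 0%N) (d) hc1 ha0 => [|m] [|d'] h1 h2 /=;
  rewrite ?(h1 erefl isT); lia.
Qed.

(** * Multiple series as limits *)

Lemma chain_ge1 k l : path geq k (rcons l 1%N) -> (0 < k)%N.
Proof.
move=> /(order_path_min (rev_trans leq_trans)) /allP; apply.
by rewrite mem_rcons mem_head.
Qed.

Lemma mem_bounded_chains m n l : (0 < n)%N ->
  (l \in bounded_chains m n) = (size l == m) && path geq n (rcons l 1%N).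
Proof.
elim: m n l => [|m IH] n l n0; first by case: l => //=; rewrite n0.
apply/allpairsPdep/andP => [[k [l' []]]|].
  rewrite mem_index_iota ltnS => /andP[k0 kn]; rewrite IH// => /andP[sl pl] ->.
  by rewrite /= eqSS sl kn.
case: l => [|k l] [//]; rewrite eqSS /= => sl /andP[kn pl].
have k0 := chain_ge1 pl.
by exists k, l; rewrite mem_index_iota ltnS k0 kn IH// sl pl.
Qed.

Lemma bounded_chains_uniq m n : uniq (bounded_chains m n).
Proof.
elim: m n => [//|m IH] n.
apply: allpairs_uniq_dep => [|k _|]; rewrite ?iota_uniq//.
by move=> [k l] [k' l'] _ _ /= [-> ->].
Qed.

Lemma bounded_chains_sub m n : (0 < n)%N ->
  [set` bounded_chains m n] `<=` chains m.
Proof.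
move=> n0 l /=; rewrite mem_bounded_chains// => /andP[/eqP sl pl].
by split => //; apply: path_sorted pl.
Qed.

Lemma chains_bounded m n l : chains m l -> (head 1 l <= n)%N ->
  l \in bounded_chains m n.
Proof.
case=> sl cl hn.
have p : path geq n (rcons l 1%N).
  by case: l cl hn {sl} => [|k l] /= cl hn; rewrite hn ?cl.
by rewrite mem_bounded_chains ?sl ?eqxx//; apply: chain_ge1 p.
Qed.

Lemma ler_sum_sub (R : numDomainType) (T : eqType) (s t : seq T) (f : T -> R) :
  uniq s -> uniq t -> {subset s <= t} -> (forall x, 0 <= f x) ->
  \sum_(x <- s) f x <= \sum_(x <- t) f x.
Proof.
move=> us ut st f0; rewrite [leRHS](bigID (mem s))/= -[leLHS]addr0.
rewrite lerD ?sumr_ge0// le_eqVlt; apply/orP; left; apply/eqP.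
rewrite -[RHS]big_filter; apply: perm_big; apply: uniq_perm => //.
  exact: filter_uniq.
by move=> x; rewrite mem_filter /=; case: (boolP (x \in s)) => //= /st ->.
Qed.

Lemma sum_bounded_chains_homo (R : numDomainType) m (f : seq nat -> R) :
  (forall l, 0 <= f l) -> {homo (fun n => \sum_(l <- bounded_chains m n) f l) :
    n n' / (n <= n')%N >-> n <= n'}.
Proof.
move=> f0 n n' nn'; case: m => [//|m]; rewrite !sum_bounded_chainsS.
by rewrite [leRHS](big_cat_nat _ (n := n.+1))//= lerDl !sumr_ge0// => *;
  rewrite sumr_ge0.
Qed.

(** Every finite set of chains lies in some [bounded_chains m n], so the supremum
over finite sets of chains is the limit of the truncated sums. *)
Lemma esum_chains (R : realType) m (f : seq nat -> R) (M : R) :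
  (forall l, 0 <= f l) ->
  (fun n => \sum_(l <- bounded_chains m n) f l) @ \oo --> M ->
  \esum_(l in chains m) (f l)%:E = M%:E.
Proof.
move=> f0 fM; apply/eqP; rewrite eq_le; apply/andP; split.
  apply: ge_ereal_sup => _ [A [/finite_seqP[s ->] sub]] <-.
  have -> : [set` s] = [set` undup s].
    by apply/seteqP; split => x /=; rewrite mem_undup.
  rewrite -fsbig_seq ?undup_uniq// sumEFin lee_fin.
  pose N := \max_(l <- s) head 1%N l.
  apply: (@le_trans _ _ (\sum_(l <- bounded_chains m N) f l)).
    apply: ler_sum_sub; rewrite ?undup_uniq ?bounded_chains_uniq//.
    move=> l; rewrite mem_undup => ls; apply: chains_bounded; first exact: sub.
    exact: leq_bigmax_seq.
  rewrite -(cvg_lim _ fM)//; apply: nondecreasing_cvgn_le.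
    exact: sum_bounded_chains_homo.
  by apply/cvg_ex; exists M.
have le n : (0 < n)%N -> ((\sum_(l <- bounded_chains m n) f l)%:E
    <= \esum_(l in chains m) (f l)%:E)%E.
  move=> n0; apply: esum_ge; exists [set` bounded_chains m n].
    by split; [exact: finite_seq | exact: bounded_chains_sub].
  by rewrite -fsbig_seq ?bounded_chains_uniq// sumEFin.
move: le; case: (\esum_(l in _) _)%E => [r| |] le; last 2 first.
- by rewrite leey.
- by have := le 1%N isT.
rewrite lee_fin; apply: cvgr_to_le fM _.
by exists 1%N => // n /= n0; rewrite -lee_fin le.
Qed.

Lemma weight_ratio_cvg (R : realType) k :
  (n - k)%N%:R / (n + k.+1)%N%:R @[n --> \oo] --> (1 : R).
Proof.
rewrite -(cvg_shiftn k) /=.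
have -> : (fun n => (n + k - k)%N%:R / (n + k + k.+1)%N%:R : R) =
    (fun n => 1 - k.*2.+1%:R * harmonic (n + k.*2)%N).
  apply/funext => n; rewrite addnK /harmonic.
  have -> : (n + k + k.+1 = (n + k.*2).+1)%N by lia.
  apply: (mulIf (_ : (n + k.*2).+1%:R != 0)); first by rewrite pnatr_eq0.
  rewrite mulrBl -mulrA mulVf ?pnatr_eq0// -mulrA mulVf ?pnatr_eq0//.
  by rewrite !mulr1 mul1r -!natr1 natrD; ring.
have h : harmonic (n + k.*2)%N @[n --> \oo] --> (0 : R).
  by rewrite (cvg_shiftn k.*2 (@harmonic R)); exact: cvg_harmonic.
have := cvgB (cvg_cst (1 : R)) (cvgM (cvg_cst (k.*2.+1%:R : R)) h).
rewrite mulr0 subr0 => h'; exact: h'.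
Qed.

Lemma weight_cvg (R : realType) k : weight R n k @[n --> \oo] --> (1 : R).
Proof.
elim: k => [|k IH].
  by under eq_fun do rewrite weight0; exact: cvg_cst.
under eq_fun do rewrite weightS.
have := cvgM IH (@weight_ratio_cvg R k); rewrite mulr1 => h; exact: h.
Qed.

(** Tannery's theorem for nonnegative terms: the weighted sum is at most the plain
one, and at least its own first [K] terms, which tend to the plain partial sum. *)
Lemma weighted_sum_cvg (R : realType) (a : nat -> R) (M : R) :
  (forall k, 0 <= a k) ->
  (fun n => \sum_(1 <= k < n.+1) a k) @ \oo --> M ->
  (fun n => \sum_(1 <= k < n.+1) weight R n k * a k) @ \oo --> M.
Proof.
move=> a0 aM.
have a_le n : \sum_(1 <= k < n.+1) a k <= M.
  rewrite -(cvg_lim _ aM)//; apply: nondecreasing_cvgn_le; last first.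
    by apply/cvg_ex; exists M.
  move=> i j ij; rewrite [leRHS](big_cat_nat _ (n := i.+1))//=.
  by rewrite lerDl sumr_ge0.
have wa_le n : \sum_(1 <= k < n.+1) weight R n k * a k
    <= \sum_(1 <= k < n.+1) a k.
  by apply: ler_sum => k _; rewrite ler_piMl// weight_le1.
apply/cvgrPdist_lt => eps eps0.
have /cvgrPdist_lt/(_ (eps / 2)) [|K _ /(_ K)] := aM; first by rewrite divr_gt0.
move=> /(_ (leqnn K)) aK.
have wK : (fun n => \sum_(1 <= k < K.+1) weight R n k * a k) @ \oo
    --> \sum_(1 <= k < K.+1) a k.
  apply: cvg_big => [|k _]; first exact: add_continuous.
  have := cvgM (@weight_cvg R k) (cvg_cst (a k)); rewrite mul1r => h; exact: h.
have /cvgrPdist_lt/(_ (eps / 2)) [|N _ hN] := wK; first by rewrite divr_gt0.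
exists (maxn K N) => // n; rewrite /= geq_max => /andP[Kn Nn].
have wn : \sum_(1 <= k < K.+1) weight R n k * a k
    <= \sum_(1 <= k < n.+1) weight R n k * a k.
  rewrite [leRHS](big_cat_nat _ (n := K.+1))//= lerDl sumr_ge0// => k _.
  by rewrite mulr_ge0 ?weight_ge0.
move: (hN n Nn) aK; rewrite !ltr_norml => /andP[_ h1] /andP[_ h2].
have h3 := a_le n; have h4 := wa_le n.
by apply/andP; split; lra.
Qed.

Lemma weighted_esum (R : realType) d (F : seq nat -> R) (B : R) :
  (forall l, 0 <= F l) ->
  (forall n, \sum_(l <- bounded_chains d.+1 n) F l <= B) ->
  exists2 M : R, \esum_(l in chains d.+1) (F l)%:E = M%:E &
    (fun n => \sum_(1 <= k < n.+1)
       weight R n k * \sum_(l <- bounded_chains d k) F (k :: l)) @ \oo --> M.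
Proof.
move=> F0 FB; pose u n := \sum_(l <- bounded_chains d.+1 n) F l.
have uM : u @ \oo --> limn u.
  apply: nondecreasing_is_cvgn; first exact: sum_bounded_chains_homo.
  by exists B => _ [n _ <-]; exact: FB.
exists (limn u); first exact: esum_chains.
apply: weighted_sum_cvg => [k|]; first by rewrite sumr_ge0.
by under eq_fun do rewrite -sum_bounded_chainsS.
Qed.

(** The positive and negative parts are dominated by the absolute values, so each
of them has a weighted limit. *)
Lemma weighted_abs_sum (R : realType) d (F : seq nat -> R) (B : R) :
  (forall n, \sum_(l <- bounded_chains d.+1 n) `|F l| <= B) ->
  exists M : R, [/\ summable (chains d.+1) (EFin \o F),
    abs_sum (chains d.+1) F = M%:E &
    (fun n => \sum_(1 <= k < n.+1)
       weight R n k * \sum_(l <- bounded_chains d k) F (k :: l)) @ \oo --> M].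
Proof.
move=> FB; have [A hA _] := weighted_esum (fun l => normr_ge0 (F l)) FB.
have part (G : seq nat -> R) : (forall l, G l <= `|F l|) -> forall n,
    \sum_(l <- bounded_chains d.+1 n) G l <= B.
  by move=> GF n; apply: le_trans (FB n); apply: ler_sum => l _.
have [||P hP cP] := @weighted_esum R d (fun l => Num.max (F l) 0) B.
- by move=> l; rewrite le_max lexx orbT.
- by apply: part => l; rewrite ge_max ler_norm normr_ge0.
have [||N hN cN] := @weighted_esum R d (fun l => Num.max (- F l) 0) B.
- by move=> l; rewrite le_max lexx orbT.
- by apply: part => l; rewrite ge_max normr_ge0 andbT -normrN ler_norm.
exists (P - N); split.
- by rewrite /summable /= hA ltry.
- rewrite /abs_sum.
  rewrite (@eq_esum _ _ _ _ (fun l => (Num.max (F l) 0)%:E)); last first.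
    by move=> l _; rewrite funeposE EFin_max.
  rewrite (@eq_esum _ _ _ (_ ^\-)%E (fun l => (Num.max (- F l) 0)%:E)).
    by rewrite hP hN EFinB.
  by move=> l _; rewrite funenegE EFin_max EFinN.
pose W (G : seq nat -> R) n := \sum_(1 <= k < n.+1)
  weight R n k * \sum_(l <- bounded_chains d k) G (k :: l).
suff e : W F = W (fun l => Num.max (F l) 0) \- W (fun l => Num.max (- F l) 0).
  rewrite -/(W F) e; exact: cvgB cP cN.
apply/funext => n; rewrite /W /= -sumrB; apply: eq_bigr => k _.
rewrite -mulrBr -sumrB; congr (_ * _); apply: eq_bigr => l _.
by rewrite /Num.max; case: ltrP => h; case: ltrP => h'; lra.
Qed.

Lemma zeta_star_rhs (R : realType) d a c e : (e <= 1)%N ->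
  (forall i, (1 <= i <= d)%N -> (0 < c i)%N /\ c i <> 2%N) ->
  (a 0%N = 0%N -> (1 <= d)%N -> (3 <= c 1%N)%N) ->
  (d = 0%N -> (1 <= a 0%N)%N) ->
  let F := rhs_term (@sharp_factor R) d a c e in
  summable (chains d.+1) (EFin \o F) /\
  zeta_star R (arg_string d a c ++ nseq e 1%N)
    = (((-1) ^+ e.+1)%:E * abs_sum (chains d.+1) F)%E.
Proof.
move=> e1 hc hc1 ha0 F; set s := _ ++ _.
have [B FB] := sum_abs_bound R e1 hc hc1 ha0.
have [M [FS -> FM]] := weighted_abs_sum FB; split => //.
rewrite /zeta_star -EFinM; apply: esum_chains => [l|].
  by rewrite prodr_ge0// => i _; rewrite invr_ge0 exprn_ge0.
have : (fun n => (-1) ^+ e.+1 * \sum_(1 <= k < n.+1)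
       weight R n k * column (-1) d a c e k) @ \oo --> (-1) ^+ e.+1 * M.
  exact: cvgM (cvg_cst _) FM.
apply: cvg_trans; apply: near_eq_cvg; near=> n.
have n0 : (0 < n)%N by near: n; exists 1%N.
rewrite -star_bounded_chains (expands_column R a e1 hc n0) big_distrr/=.
by apply: eq_bigr => k _; rewrite mulrCA.
Unshelve. all: by end_near.
Qed.

Theorem theorem1p6 (R : realType) (d : nat) (a c : nat -> nat)
    (hc : forall i : nat, (1 <= i <= d)%N -> (0 < c i)%N /\ c i <> 2%N)
    (hc1 : a 0%N = 0%N -> (1 <= d)%N -> (3 <= c 1%N)%N)
    (ha0 : d = 0%N -> (1 <= a 0%N)%N) :
  let K := chains d.+1 in
  let s := arg_string d a c in
  let formulas (S : nat -> nat -> nat -> R) :=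
    let F1 := rhs_term S d a c 0 in
    let F2 := rhs_term S d a c 1 in
    (summable K (EFin \o F1) /\
       zeta_star R s = (- abs_sum K F1)%E) /\
    (summable K (EFin \o F2) /\
       zeta_star R (rcons s 1%N) = abs_sum K F2) in
  formulas (@sharp_factor R) /\ formulas (@sharp_factor_repl R).
Proof.
move=> K s formulas; rewrite sharp_factor_replE.
suff : formulas (@sharp_factor R) by [].
split.
  have [S1 zeta1] := zeta_star_rhs R (leq0n 1) hc hc1 ha0; split => //.
  by move: zeta1; rewrite cats0 expr1 mulN1e.
have [S2 zeta2] := zeta_star_rhs R (leqnn 1) hc hc1 ha0; split => //.
by move: zeta2; rewrite cats1 sqrrN expr1n mul1e.
Qed.
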